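(* Let $V$ be a labelled vertex set with $|V|=N$, let $L$ be a graph on $V$, and let $p\in[0,1]$. Then $$\Pr\big[F\in\mathcal{G}(N,p): F_R^{1/2}=L\big]=\Big(\frac{p}{2}\Big)^{e(L)}\Big(1-\frac{p}{2}\Big)^{\binom{N}{2}-e(L)}.$$ Namely, for $F\in\mathcal{G}(N,p)$ the red graphs $F_R^{1/2}$ form $\mathcal{G}(N,p/2)$.
   Context: $\mathcal{G}(N,p)$ is the Erdős–Rényi random graph space on the labelled vertex set $V$, in which each edge of the complete graph on $V$ appears independently with probability $p$. $e(L)$ denotes the number of edges of $L$. For a graph $F$ on $V$, color each edge of $F$ red or blue with probability $1/2$ for each color, randomly and independently; $F_R^{1/2}$ denotes the random graph on $V$ whose edges are the red edges of $F$. When $F$ is itself random in $\mathcal{G}(N,p)$, the probability is over both the choice of $F$ and the random coloring (the coloring being chosen, given $F$, as just described). Equality $F_R^{1/2}=L$ means equality as labelled graphs on $V$. *)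

(* Defs.v *)
From HB Require Import structures.
From mathcomp Require Export all_boot all_order all_algebra.
From mathcomp Require Export all_classical all_reals all_analysis.

Set Implicit Arguments.
Unset Strict Implicit.
Unset Printing Implicit Defensive.

Import Order.TTheory GRing.Theory Num.Theory.

Local Open Scope classical_set_scope.
Local Open Scope ring_scope.

Definition complete_edges (V : finType) : {set {set V}} :=
  [set e : {set V} | #|e| == 2%N]%SET.

(* Labelled simple graphs on V; Leibniz equality of sgraphs is equality of
   edge sets, i.e. equality as labelled graphs. *)
Record sgraph (V : finType) := SGraph {
  edges : {set {set V}};
  edges_complete : edges \subset complete_edges V
}.

HB.instance Definition _ (V : finType) := [isSub for @edges V].
HB.instance Definition _ (V : finType) := [Finite of sgraph V by <:].

Variant color := Red | Blue.

Definition is_red (c : color) : bool := if c is Red then true else false.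

(* Colorings are total on {set V}; only the colors of the edges of F matter. *)
Definition red_edges (V : finType) (F : sgraph V) (c : {set V} -> color) :
    {set {set V}} :=
  [set e in edges F | is_red (c e)]%SET.

Lemma red_edges_complete (V : finType) (F : sgraph V) (c : {set V} -> color) :
  red_edges F c \subset complete_edges V.
Proof.
apply: fintype.subset_trans (edges_complete F).
by apply/fintype.subsetP => e; rewrite inE => /andP[].
Qed.

Definition red_graph (V : finType) (F : sgraph V) (c : {set V} -> color) :
    sgraph V :=
  SGraph (red_edges_complete F c).

(* Mutual independence, under the set function Q, of the events E i for i in A:
   the product rule for every finite subfamily. *)
Definition mutually_independent (R : realType) (T : Type) (Q : set T -> \bar R)
    (I : finType) (A : {set I}) (E : I -> set T) : Prop :=
  forall J : {set I}, J \subset A ->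
    Q (\bigcap_(i in [set` J]) E i) = (\prod_(i in J) Q (E i))%E.

(* Conditional probability Pr[A | B]; only used when P B != 0. *)
Definition cond_prob (R : realType) (d : measure_display)
    (T : measurableType d) (P : probability T R) (B A : set T) : \bar R :=
  (fine (P (A `&` B)) / fine (P B))%:E.

(* The random graph F, defined on the probability space (T, P), is distributed
   as G(N, p) on the vertex set V, where N = #|V|. *)
Definition erdos_renyi (R : realType) (d : measure_display)
    (T : measurableType d) (P : probability T R) (V : finType)
    (p : R) (F : T -> sgraph V) : Prop :=
  [/\ forall e, e \in complete_edges V -> measurable [set w | e \in edges (F w)],
      forall e, e \in complete_edges V -> P [set w | e \in edges (F w)] = p%:E
    & mutually_independent P (complete_edges V)
        (fun e => [set w | e \in edges (F w)])].

(* Given F, the edges of F are colored independently, each color having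
   conditional probability 1/2. *)
Definition random_coloring (R : realType) (d : measure_display)
    (T : measurableType d) (P : probability T R) (V : finType)
    (F : T -> sgraph V) (C : T -> {set V} -> color) : Prop :=
  (forall e k, e \in complete_edges V -> measurable [set w | C w e = k]) /\
  (forall G : sgraph V, P [set w | F w = G] != 0%E ->
     (forall e k, e \in edges G ->
        cond_prob P [set w | F w = G] [set w | C w e = k] = (2^-1)%:E) /\
     (forall c : {set V} -> color,
        mutually_independent (cond_prob P [set w | F w = G]) (edges G)
          (fun e => [set w | C w e = c e]))).

(* Main.v *)
Require Import Defs.
From mathcomp Require Import all_boot all_order all_algebra.
From mathcomp Require Import all_classical all_reals all_analysis.
From mathcomp Require Import ring.

(** An edge set [J] lies in the red graph iff it lies in [F] and is entirely
    red; conditioning on [F] gives probability [2^-|J| * p^|J| = (p/2)^|J|].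
    The law of a random graph is determined by these inclusion probabilities:
    the probability that [A] is present and [B] absent follows by removing the
    edges of [B] one at a time. *)

Set Implicit Arguments.
Unset Strict Implicit.
Unset Printing Implicit Defensive.

Import Order.TTheory GRing.Theory Num.Theory.

Local Open Scope classical_set_scope.
Local Open Scope ring_scope.

(** * Total probability and product rules for finite families of events *)

Lemma total_probability (R : realType) (d : measure_display)
    (T : measurableType d) (P : probability T R) (I : finType) (H : T -> I)
    (Y : set T) :
  (forall i, measurable [set w | H w = i]) -> measurable Y ->
  P Y = (\sum_(i : I) P ([set w | H w = i] `&` Y))%E.
Proof.
move=> mH mY.
have {1}-> : Y = \bigcup_(i in [set: I]) ([set w | H w = i] `&` Y).
  by apply/seteqP; split=> [w Yw|w [i _ []]//]; exists (H w).
have finI : finite_set [set: I] by exact: finite_finset.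
rewrite measure_fin_bigcup//.
- rewrite fsbig_finite//= big_uniq/= ?finmap.fset_uniq//.
  by apply: eq_bigl => i; rewrite in_fset_set// mem_set.
- by move=> i j _ _ [w [[/= <- _] [/= <- _]]].
- by move=> i _; apply: measurableI.
Qed.

(** Translates between the intersections in [mutually_independent] and inclusion events. *)
Lemma bigcap_edges (T : Type) (V : finType) (H : T -> sgraph V)
    (J : {set {set V}}) :
  \bigcap_(e in [set` J]) [set w | e \in edges (H w)] =
  [set w | J \subset edges (H w)].
Proof.
apply/seteqP; split=> w /=.
  by move=> JH; apply/fintype.subsetP => e /JH.
by move=> /fintype.subsetP JH e /JH.
Qed.

(** [Q] is an arbitrary set function, so that this serves both the edges of [F] under [P] and their
    colors under [cond_prob]. *)
Lemma mutually_independent_const (R : realType) (T : Type)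
    (Q : set T -> \bar R) (I : finType) (A : {set I}) (E : I -> set T) (q : R) :
  mutually_independent Q A E -> (forall i, i \in A -> Q (E i) = q%:E) ->
  forall J : {set I}, J \subset A ->
    Q (\bigcap_(i in [set` J]) E i) = (q ^+ #|J|)%:E.
Proof.
move=> indE QE J JA; rewrite indE// (eq_bigr (fun=> q%:E)).
  by rewrite prodEFin prodr_const.
by move=> i iJ; rewrite QE// (fintype.subsetP JA).
Qed.

(** * The law of a random graph from its inclusion probabilities *)

Section random_graph.
Context (R : realType) (d : measure_display) (T : measurableType d).
Context (P : probability T R) (V : finType) (H : T -> sgraph V).

Hypothesis mH :
  forall e, e \in complete_edges V -> measurable [set w | e \in edges (H w)].

Lemma measurable_edge (e : {set V}) : measurable [set w | e \in edges (H w)].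
Proof.
have [/mH//|eK] := boolP (e \in complete_edges V).
(* Here [e] is not a pair of vertices, so no graph contains it. *)
rewrite (_ : [set w | _] = set0)//; apply/seteqP; split=> // w /= eH.
by move: eK; rewrite (fintype.subsetP (edges_complete (H w))).
Qed.

Lemma measurable_subgraph (A : {set {set V}}) :
  measurable [set w | A \subset edges (H w)].
Proof.
rewrite -bigcap_edges; apply: fin_bigcap_measurable => // e _.
exact: measurable_edge.
Qed.

Lemma measurable_avoid (B : {set {set V}}) :
  measurable [set w | [disjoint B & edges (H w)]%B].
Proof.
rewrite (_ : [set w | _] =
    \bigcap_(e in [set` B]) ~` [set w | e \in edges (H w)]).
  by apply: fin_bigcap_measurable => // e _; apply/measurableC/measurable_edge.
apply/seteqP; split=> w /=.
  by move=> BH e /= eB; rewrite (disjointFr BH eB).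
move=> BH; rewrite finset.disjoints_subset; apply/fintype.subsetP => e.
by move=> /BH /= /negP; rewrite finset.in_setC.
Qed.

(** Every edge of [H w] is a pair of vertices, so avoiding all pairs outside [L] forces [H w] into
    [L]. *)
Lemma eq_graphE (L : sgraph V) :
  [set w | H w = L] =
  [set w | edges L \subset edges (H w)] `&`
  [set w | [disjoint complete_edges V :\: edges L & edges (H w)]%B].
Proof.
apply/seteqP; split=> w /=.
  by move=> ->; split=> //; rewrite -finset.setI_eq0 finset.setIDAC
    finset.setDIl finset.setDv finset.setI0.
move=> [LH KH]; apply/val_inj/eqP; rewrite finset.eqEsubset LH andbT/=.
apply/fintype.subsetP => e eH; apply: contraT => eL.
have /(disjointFr KH) : e \in complete_edges V :\: edges L.
  by rewrite finset.in_setD eL (fintype.subsetP (edges_complete (H w))).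
by rewrite eH.
Qed.

Lemma measurable_eq_graph (L : sgraph V) : measurable [set w | H w = L].
Proof.
rewrite eq_graphE; apply: measurableI; first exact: measurable_subgraph.
exact: measurable_avoid.
Qed.

Variable q : R.
Hypothesis PH : forall A : {set {set V}}, A \subset complete_edges V ->
  P [set w | A \subset edges (H w)] = (q ^+ #|A|)%:E.

Lemma probability_subgraph_avoid (A B : {set {set V}}) :
  A \subset complete_edges V -> B \subset complete_edges V ->
  [disjoint A & B]%B ->
  P ([set w | A \subset edges (H w)] `&`
     [set w | [disjoint B & edges (H w)]%B]) =
  (q ^+ #|A| * (1 - q) ^+ #|B|)%:E.
Proof.
(* [A] stays general in the induction on the size of [B]: the edge [e] removed from [B] is added to
   [A] in one of the two uses of the hypothesis. *)
have [n] := ubnP #|B|; elim: n A B => // n IHn A B; rewrite ltnS => Bn AK BK AB.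
have [->|[e eB]] := set_0Vmem B.
  rewrite cards0 expr0 mulr1 -PH//; congr (P _); apply/seteqP; split=> w /=.
    by case.
  by move=> AH; split=> //; rewrite -finset.setI_eq0 finset.set0I.
pose B' := B :\ e.
have cB : #|B| = #|B'|.+1 by rewrite (cardsD1 e) eB.
have B'n : (#|B'| < n)%N by rewrite -cB.
have B'K : B' \subset complete_edges V.
  by apply: fintype.subset_trans BK; apply: finset.subD1set.
have AB' : [disjoint A & B']%B by apply: disjointWr AB; apply: finset.subD1set.
have eA : e \notin A by rewrite (disjointFl AB eB).
have eK := fintype.subsetP BK _ eB.
have eAK : e |: A \subset complete_edges V.
  by rewrite finset.subUset finset.sub1set eK.
have eAB' : [disjoint e |: A & B']%B.
  by rewrite -finset.setI_eq0 finset.setIUl finset.setU_eq0 !finset.setI_eq0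
    AB' andbT disjoints1 !inE eqxx.
pose E (X Y : {set {set V}}) := [set w | X \subset edges (H w)] `&`
  [set w | [disjoint Y & edges (H w)]%B].
have mE X Y : measurable (E X Y).
  apply: measurableI; first exact: measurable_subgraph.
  exact: measurable_avoid.
have PA := IHn A B' B'n AK B'K AB'.
have PeA := IHn (e |: A) B' B'n eAK B'K eAB'.
rewrite -/(E A B') in PA; rewrite -/(E (e |: A) B') in PeA; rewrite -/(E A B).
(* Avoiding [B] means avoiding [B'] and not containing [e]. With a = |A| and b = |B'|, the
   probabilities then give q^a (1-q)^b - q^(a+1) (1-q)^b = q^a (1-q)^(b+1). *)
have -> : E A B = E A B' `\` E (e |: A) B'.
  have BE : B = e |: B' by rewrite finset.setD1K.
  apply/seteqP; rewrite /E BE; split=> w /=;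
    rewrite !finset.subUset !finset.sub1set -!finset.setI_eq0 !finset.setIUl
    !finset.setU_eq0 !finset.setI_eq0 disjoints1.
    move=> [AH /andP[eH B'H]]; split=> //.
    by rewrite AH andbT (negbTE eH); case.
  by move=> [[AH B'H] eH]; split=> //; rewrite B'H andbT; apply/negP => eH';
    apply: eH; rewrite eH' AH.
rewrite measureD//; last by rewrite ltey_eq fin_num_measure.
(* The removed event lies inside [E A B'], so its full probability is subtracted. *)
rewrite setIidr; last first.
  by move=> w [/=]; rewrite finset.subUset => /andP[].
apply: etrans (congr2 (fun x y => x - y)%E PA PeA) _.
rewrite -EFinB cardsU1 eA cB add1n !exprS; congr (_%:E).
by move: (q ^+ #|A|) ((1 - q) ^+ #|B'|) => x y; ring.
Qed.

Lemma probability_eq_graph (L : sgraph V) :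
  P [set w | H w = L] =
  (q ^+ #|edges L| * (1 - q) ^+ ('C(#|V|, 2) - #|edges L|))%:E.
Proof.
have LK := edges_complete L.
rewrite eq_graphE probability_subgraph_avoid//.
(* The natural-number subtraction does not truncate, since [edges L] lies among the ['C(#|V|, 2)]
   pairs. *)
- by rewrite cardsDS// /complete_edges card_draws.
- exact: finset.subsetDl.
- by rewrite -finset.setI_eq0 finset.setIDA finset.setIC -finset.setIDA
    finset.setDv finset.setI0.
Qed.

(** Singletons in [PH] give the edge probability [q]; larger sets then give the product rule. *)
Lemma erdos_renyi_of_subgraph_probability : erdos_renyi P q H.
Proof.
have P1 e : e \in complete_edges V -> P [set w | e \in edges (H w)] = q%:E.
  move=> eK; have := @PH [set e]%SET.
  rewrite finset.sub1set cards1 expr1 => <-//.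
  by congr (P _); apply/seteqP; split=> w /=; rewrite finset.sub1set.
split=> // J JK; rewrite bigcap_edges PH// (eq_bigr (fun=> q%:E)).
  by rewrite prodEFin prodr_const.
by move=> e eJ; rewrite P1// (fintype.subsetP JK).
Qed.

End random_graph.

(** * Inclusion probabilities of the red graph *)

Section red_graph.
Context (R : realType) (d : measure_display) (T : measurableType d).
Context (P : probability T R) (V : finType) (p : R).
Context (F : T -> sgraph V) (C : T -> {set V} -> color).
Hypothesis hF : erdos_renyi P p F.
Hypothesis hC : random_coloring P F C.

Lemma red_graph_edgeE (e : {set V}) :
  [set w | e \in edges (red_graph (F w) (C w))] =
  [set w | e \in edges (F w)] `&` [set w | C w e = Red].
Proof.
apply/seteqP; split=> w /=; rewrite inE.
  by move=> /andP[->]; case: (C w e).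
by move=> [-> ->].
Qed.

Lemma measurable_red_edge (e : {set V}) : e \in complete_edges V ->
  measurable [set w | e \in edges (red_graph (F w) (C w))].
Proof.
move=> eK; rewrite red_graph_edgeE.
case: hF => mF _ _; case: hC => mC _.
by apply: measurableI; [exact: mF|exact: mC].
Qed.

(** If [J] is not contained in [G], both events are empty; otherwise the colors on [J] are
    conditionally independent given [F = G]. Keeping the event that [J] lies in [F] on the right
    makes the factor the same for all [G], so the identity can be summed over [G]. *)
Lemma probability_graph_red_subset (J : {set {set V}}) (G : sgraph V) :
  J \subset complete_edges V ->
  P ([set w | F w = G] `&`
     [set w | J \subset edges (red_graph (F w) (C w))]) =
  ((2^-1 ^+ #|J|)%:E *
   P ([set w | F w = G] `&` [set w | J \subset edges (F w)]))%E.
Proof.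
move=> JK; case: hF => mF _ _; case: hC => mC condC.
have mG := measurable_eq_graph mF G.
have redE w : (J \subset edges (red_graph (F w) (C w))) <->
    (J \subset edges (F w)) /\ (forall e, e \in J -> C w e = Red).
  split.
    move=> /fintype.subsetP Jr; split.
      by apply/fintype.subsetP => e /Jr; rewrite inE => /andP[].
    by move=> e /Jr; rewrite inE => /andP[_]; case: (C w e).
  move=> [/fintype.subsetP JF Jr]; apply/fintype.subsetP => e eJ.
  by rewrite inE JF//= Jr.
have [JG|JG] := boolP (J \subset edges G); last first.
  rewrite (_ : _ `&` _ = set0); last first.
    by apply/seteqP; split=> // w [/= FG /redE[]]; rewrite FG (negbTE JG).
  rewrite (_ : _ `&` _ = set0) ?measure0 ?mule0//.
  by apply/seteqP; split=> // w [/= ->]; rewrite (negbTE JG).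
have -> : [set w | F w = G] `&` [set w | J \subset edges (F w)] =
    [set w | F w = G].
  by apply/seteqP; split=> w /=; [case|move=> ->].
set S := \bigcap_(e in [set` J]) [set w | C w e = Red].
have mS : measurable S.
  apply: fin_bigcap_measurable => // e /= eJ.
  by apply: mC; rewrite (fintype.subsetP JK).
have -> : [set w | F w = G] `&`
    [set w | J \subset edges (red_graph (F w) (C w))] = S `&` [set w | F w = G].
  apply/seteqP; split=> w /=.
    by move=> [FG /redE[_ Jr]].
  by move=> [Jr FG]; split=> //; apply/redE; rewrite FG.
(* Nothing is assumed about colors given a null event [F = G]; there both sides vanish by
   monotonicity. *)
have [PG0|PG0] := eqVneq (P [set w | F w = G]) 0%E.
  rewrite PG0 mule0; apply: subset_measure0 PG0 => //.
  exact: measurableI.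
have [half indC] := condC _ PG0.
have [] : cond_prob P [set w | F w = G] S = (2^-1 ^+ #|J|)%:E.
  apply: (mutually_independent_const (indC (fun=> Red)) _ JG) => e eG.
  exact: half.
(* Clears the denominator of [cond_prob]; its real value is nonzero because [P] is finite and [PG0]
   holds. *)
move=> /(canRL (divfK _)) SG.
rewrite -[LHS]fineK ?fin_num_measure//; last exact: measurableI.
rewrite SG ?EFinM ?fineK ?fin_num_measure//.
by rewrite fine_eq0 ?fin_num_measure.
Qed.

Lemma probability_red_subset (J : {set {set V}}) :
  J \subset complete_edges V ->
  P [set w | J \subset edges (red_graph (F w) (C w))] = ((p / 2) ^+ #|J|)%:E.
Proof.
move=> JK; case: (hF) => mF PF indF.
have mFG := measurable_eq_graph mF.
(* Total probability is used twice: to split over the values of [F], then, once the common factor is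
   pulled out, to reassemble the probability that [J] lies in [F]. *)
rewrite (total_probability P mFG); last first.
  exact: measurable_subgraph measurable_red_edge _.
rewrite (eq_bigr _ (fun G _ => probability_graph_red_subset G JK)).
rewrite -ge0_sume_distrr//.
rewrite -(total_probability P mFG); last exact: measurable_subgraph.
rewrite -bigcap_edges (mutually_independent_const indF PF)//.
by rewrite -EFinM mulrC exprMn.
Qed.

End red_graph.

Theorem lemma1 (R : realType) (d : measure_display) (T : measurableType d)
    (P : probability T R) (V : finType) (N : nat) (hN : #|V| = N)
    (p : R) (hp : 0 <= p <= 1)
    (F : T -> sgraph V) (C : T -> {set V} -> color)
    (hF : erdos_renyi P p F) (hC : random_coloring P F C) :
  (forall L : sgraph V,
     P [set w | red_graph (F w) (C w) = L] =
     ((p / 2) ^+ #|edges L| * (1 - p / 2) ^+ ('C(N, 2) - #|edges L|))%:E) /\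
  erdos_renyi P (p / 2) (fun w => red_graph (F w) (C w)).
Proof.
have mr := measurable_red_edge hF hC.
have Pr := probability_red_subset hF hC.
pose H w := red_graph (F w) (C w).
split; last exact: (@erdos_renyi_of_subgraph_probability _ _ _ P _ H mr _ Pr).
by move=> L; rewrite -hN; exact: (@probability_eq_graph _ _ _ P _ H mr _ Pr L).
Qed.
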